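(* Let $n, q \ge 1$ and $s \geq 2$ be integers. The total number $C_B(n, q, s)$ of $s$-collisions in all arrangements of $q$ numbered balls in $n$ numbered buckets is equal to $$ \sum_{\lambda} \binom{n}{\lambda_1}\left( \prod_{i=2}^{k} \binom{\lambda_{i-1}}{\lambda_i} \right) \left( \lambda_{k}\binom{k}{s} + \sum_{i=s}^{k-1} ( \lambda_{i} - \lambda_{i+1} )\binom{i}{s} \right) \left(q!\Big/ \prod_{i = 1}^{k} i^{ \lambda_i} \right), $$ where the sum is over all partitions $\lambda = (\lambda_1,\dots,\lambda_k)$ of $q$ such that $\lambda_1 \leq n$ and whose number of parts $k = |\lambda|$ satisfies $k \geq s$.
   Context: A partition $\lambda$ of a positive integer $q$ is a sequence of integers $\lambda_1 \ge \lambda_2 \ge \dots \ge \lambda_k \ge 1$ with $\sum_{i=1}^k \lambda_i = q$; $k = |\lambda|$ is the number of parts (it depends on $\lambda$). An arrangement of $q$ numbered (distinguishable) balls in $n$ numbered buckets places every ball in exactly one bucket, and the order of the balls within a bucket does not matter. That is, an arrangement is a function from the set of $q$ balls to the set of $n$ buckets. Let $s \ge 2$. A bucket containing $r$ balls contributes $\binom{r}{s}$ to the number of $s$-collisions of an arrangement (so it contributes $0$ if $r < s$). The number of $s$-collisions of an arrangement is the sum of these contributions over all $n$ buckets, and $C_B(n,q,s)$ is the sum of the numbers of $s$-collisions over all arrangements of $q$ balls in $n$ buckets. Empty products equal $1$ and empty sums equal $0$. *)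

(* Defs.v *)
From HB Require Import structures.
From mathcomp Require Import all_boot.

Set Implicit Arguments.
Unset Strict Implicit.
Unset Printing Implicit Defensive.

Definition is_intpart (q : nat) (l : seq nat) : bool :=
  [&& sorted geq l, all (leq 1) l & sumn l == q].

Record intpart (q : nat) : Type := IntPart {
  intpart_seq :> seq nat;
  intpartP : is_intpart q intpart_seq
}.

HB.instance Definition _ (q : nat) := [isSub for @intpart_seq q].
HB.instance Definition _ (q : nat) := [Equality of intpart q by <:].
HB.instance Definition _ (q : nat) := [Choice of intpart q by <:].
HB.instance Definition _ (q : nat) := [Countable of intpart q by <:].

(* Parts are numbered from 1: [part l i] is the i-th part for                 *)
(* 1 <= i <= size l.  It is 0 for i > size l, and [part l 0 = part l 1].      *)
Definition part (l : seq nat) (i : nat) : nat := nth 0 l i.-1.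

Lemma intpart_size_le (l : seq nat) : all (leq 1) l -> size l <= sumn l.
Proof.
elim: l => //= x l IH /andP[x_gt0 /IH size_l].
by rewrite -add1n leq_add.
Qed.

Lemma intpart_mem_le (l : seq nat) (x : nat) : x \in l -> x <= sumn l.
Proof.
elim: l => //= y l IH; rewrite inE => /orP[/eqP-> | /IH x_le].
  exact: leq_addr.
exact: leq_trans x_le (leq_addl _ _).
Qed.

(* A partition of q has at most q parts, each at most q: this makes           *)
(* [intpart q] a finite type.                                                 *)
Definition intpart_enum (q : nat) : seq (intpart q) :=
  undup (pmap (fun t : q.-bseq 'I_q.+1 => insub (map val t))
              (enum {: q.-bseq 'I_q.+1})).

Lemma intpart_enumP (q : nat) : Finite.axiom (intpart_enum q).
Proof.
apply: Finite.uniq_enumP; first exact: undup_uniq.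
move=> l; rewrite mem_undup mem_pmap inE.
have /and3P[_ l_pos /eqP sum_l] := intpartP l.
pose m := map (fun x => inord x : 'I_q.+1) l.
have size_m : size m <= q by rewrite size_map -[leqRHS]sum_l intpart_size_le.
have m_val : map val m = l.
  rewrite -map_comp map_id_in // => x x_l.
  by rewrite /= inordK // ltnS -[leqRHS]sum_l intpart_mem_le.
apply/mapP; exists (Bseq size_m); first by rewrite mem_enum.
by rewrite /= m_val valK.
Qed.

HB.instance Definition _ (q : nat) :=
  isFinite.Build (intpart q) (@intpart_enumP q).

Definition arrangement (n q : nat) := {ffun 'I_q -> 'I_n}.

Definition collisions (n q s : nat) (f : arrangement n q) : nat :=
  \sum_(b < n) 'C(#|[set x | f x == b]|, s).

Definition C_B (n q s : nat) : nat :=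
  \sum_(f : {ffun 'I_q -> 'I_n}) collisions s f.

(* Main.v *)
Require Import Defs.
From mathcomp Require Import all_boot all_order all_algebra.
Import GRing.Theory Num.Theory.

(** Let [lambda_i] be the number of buckets holding at least [i] balls.  This
    is a partition of [q] (the conjugate of the bucket sizes), and it
    determines the number of collisions because [lambda_i - lambda_(i+1)]
    buckets hold exactly [i] balls.  The arrangements with a given partition
    are counted in two steps.  The vectors of bucket sizes correspond to the
    chains of sets [A_1 >= A_2 >= ...] with [#|A_i| = lambda_i], where [A_i] is
    the set of buckets holding at least [i] balls; this gives the product of
    binomials.  Each size vector [r] is then realised by the multinomial
    number [q! / prod_b (r b)!] of arrangements, and
    [prod_b (r b)! = prod_i i ^ lambda_i]. *)

Set Implicit Arguments.
Unset Strict Implicit.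
Unset Printing Implicit Defensive.

Section Occupancy.
Variable T : finType.
Implicit Types (r : {ffun T -> nat}) (A B : {set T}) (l : seq nat).

(* Counted from 0: [profile r i] is the part number [i.+1]. *)
Definition profile r (i : nat) : nat := #|[set b | i < r b]|.

(** * Arrangements with prescribed bucket sizes *)

Definition occ q (f : {ffun 'I_q -> T}) : {ffun T -> nat} :=
  [ffun b => #|[set x | f x == b]|].

(** Induction on [q] by removing the head [x] of a tuple, which lowers the entry of [r] at [x] by
    one. The product form of the multinomial coefficient avoids division in [nat]. *)
Lemma card_tuple_count q r : \sum_b r b = q ->
  #|[set t : q.-tuple T | [forall b, count_mem b t == r b]]| * \prod_b (r b)`!
    = q`!.
Proof.
elim: q r => [|q IHq] r sum_r.
  have r0 b : r b = 0.
    by apply/eqP; move/eqP: sum_r; rewrite sum_nat_eq0 => /forallP/(_ b).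
  rewrite big1 ?muln1 => [|b _]; last by rewrite r0.
  rewrite (_ : [set _ | _] = [set [tuple]]) ?cards1 //.
  apply/setP=> t; rewrite !inE tuple0 eqxx.
  by apply/forallP => b; rewrite r0.
pose dec x : {ffun T -> nat} := [ffun b => r b - (x == b)].
have split_card :
  #|[set t : q.+1.-tuple T | [forall b, count_mem b t == r b]]|
  = \sum_(x | 0 < r x)
      #|[set t : q.-tuple T | [forall b, count_mem b t == dec x b]]|.
  rewrite -sum1_card.
  rewrite (reindex (fun p : T * q.-tuple T => [tuple of p.1 :: p.2])) /=;
    last first.
    exists (fun t => (thead t, [tuple of behead t])) => [[x t] _|t _] /=.
      by congr pair; apply: val_inj.
    by rewrite [RHS]tuple_eta.
  under [RHS]eq_bigr do rewrite -sum1_card.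
  rewrite pair_big_dep; apply: eq_bigl => -[x t] /=; rewrite !inE.
  apply/forallP/andP => [cnt|[rx /forallP cnt] b].
    split; first by move: (cnt x); rewrite /= eqxx => /eqP<-.
    apply/forallP => b; rewrite ffunE -(eqP (cnt b)) /=.
    by rewrite addKn.
  rewrite /=; move: (cnt b); rewrite ffunE => /eqP->.
  by case: (eqVneq x b) => [<-|_]; rewrite ?subn0 // subnKC.
rewrite split_card big_distrl /=.
(* Since [(r x)! = r x * (r x - 1)!], the head [x] contributes [r x * q!], and the [r x] add up to
   [q.+1]. *)
transitivity (\sum_(x | 0 < r x) r x * q`!); last first.
  rewrite -big_distrl factS -sum_r; congr (_ * _).
  rewrite [RHS](bigID (fun x => 0 < r x)) /= [X in _ = _ + X]big1 ?addn0 //.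
  by move=> i; case: (r i).
apply: eq_bigr => x rx; rewrite -(IHq (dec x)); last first.
  apply: succn_inj; rewrite -sum_r (bigD1 x) //= [RHS](bigD1 x) //= ffunE eqxx.
  rewrite -addSn subn1 prednK //; congr (_ + _).
  by apply: eq_bigr => b; rewrite ffunE eq_sym => /negPf->; rewrite subn0.
rewrite mulnCA; congr (_ * _).
rewrite (bigD1 x) //= [X in _ = _ * X](bigD1 x) //= mulnA ffunE eqxx subn1.
rewrite -[X in X`! * _](prednK rx) factS prednK //; congr (_ * _).
by apply: eq_bigr => b; rewrite ffunE eq_sym => /negPf->; rewrite subn0.
Qed.

Lemma card_occ q r : \sum_b r b = q ->
  #|[set f : {ffun 'I_q -> T} | occ f == r]| * \prod_b (r b)`! = q`!.
Proof.
move=> sum_r; rewrite -[RHS](card_tuple_count sum_r); congr (_ * _).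
rewrite -!sum1_card (reindex (fun t : q.-tuple T => [ffun i => tnth t i])) /=.
  apply: eq_bigl => t; rewrite !inE.
  have occE b : occ [ffun i => tnth t i] b = count_mem b t.
    rewrite ffunE -sum1_card -sum1_count big_tuple.
    by apply: eq_bigl => i; rewrite inE ffunE.
  apply/eqP/forallP => [<- b|cnt]; first by rewrite occE.
  by apply/ffunP => b; rewrite occE (eqP (cnt b)).
exists (fun f : {ffun 'I_q -> T} => [tuple f i | i < q]) => [t _|f _].
  by apply: eq_from_tnth => i; rewrite tnth_mktuple ffunE.
by apply/ffunP => i; rewrite ffunE tnth_mktuple.
Qed.

Lemma sum_occ q (f : {ffun 'I_q -> T}) : \sum_b occ f b = q.
Proof.
rewrite -[RHS]card_ord -sum1_card (partition_big f xpredT) //=.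
apply: eq_bigr => b _; rewrite ffunE -sum1_card.
by apply: eq_bigl => x; rewrite inE.
Qed.

(** * Size vectors as chains of supports *)

Definition incr B r : {ffun T -> nat} := [ffun b => (b \in B) + r b].

(* Enumerates the [r] supported in [A] with profile [l]; [B] is the support.  *)
Fixpoint occs l A : seq {ffun T -> nat} :=
  if l is a :: l' then
    [seq incr B r | B <- enum [set B : {set T} | B \subset A & #|B| == a],
                    r <- occs l' B]
  else [:: [ffun=> 0]].

Lemma mem_occs l A r :
  reflect ((forall b, 0 < r b -> b \in A) /\ profile r =1 nth 0 l)
          (r \in occs l A).
Proof.
elim: l A r => [|a l IH] A r /=.
  rewrite inE; apply: (iffP eqP) => [->|[_ prof]].
    split=> [b|i]; first by rewrite ffunE.
    by rewrite nth_nil; apply: eq_card0 => b; rewrite !inE ffunE.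
  apply/ffunP => b; rewrite ffunE; apply/eqP; rewrite eqn0Ngt.
  by have /eqP := prof 0; rewrite cards_eq0 => /eqP/setP/(_ b); rewrite !inE => ->.
apply: (iffP allpairsPdep) => [[B [r' [+ /IH[supp prof] ->]]]|[supp prof]].
  rewrite mem_enum inE => /andP[/subsetP BA /eqP cB].
  have suppE b : 0 < incr B r' b = (b \in B).
    by rewrite ffunE; case: (boolP (b \in B)) => // /(contraNN (supp b))/negPf.
  split=> [b|[|i]]; first by rewrite suppE => /BA.
    by rewrite /= -cB; apply: eq_card => b; rewrite inE suppE.
  rewrite /= -prof; apply: eq_card => b; rewrite !inE ffunE.
  case: (boolP (b \in B)) => //= /(contraNN (supp b)).
  by rewrite -eqn0Ngt => /eqP->.
(* Peel off one layer: one ball leaves each nonempty bucket, which shifts the profile by one. *)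
exists [set b | 0 < r b], [ffun b => (r b).-1]; split.
- rewrite mem_enum inE; apply/andP; split.
    by apply/subsetP => b; rewrite inE; apply: supp.
  by apply/eqP; apply: (prof 0).
- apply/IH; split=> [b|i]; first by rewrite ffunE inE; case: (r b).
  rewrite -[RHS](prof i.+1); apply: eq_card => b; rewrite !inE ffunE.
  by case: (r b).
by apply/ffunP => b; rewrite !ffunE inE; case: (r b).
Qed.

(** Since [r] vanishes outside [B], the set [B] is recovered from [incr B r] as its support, and
    then [r] by cancellation. *)
Lemma occs_uniq l A : uniq (occs l A).
Proof.
elim: l A => [//|a l IH] A /=; apply: allpairs_uniq_dep => //.
  exact: enum_uniq.
move=> u v /allpairsPdep[B [r [_ /mem_occs[supp _] ->]]].
move=> /allpairsPdep[B' [r' [_ /mem_occs[supp' _] ->]]] /= /ffunP e.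
have eB : B = B'.
  apply/setP => b; have := e b; rewrite !ffunE.
  have := supp b; have := supp' b.
  case: (b \in B); case: (b \in B') => //=.
    by case: (r' b) => // ? /(_ isT).
  by case: (r b) => // ? _ /(_ isT).
subst B'; suff -> : r = r' by [].
by apply/ffunP => b; have := e b; rewrite !ffunE => /addnI.
Qed.

(** The number of choices for each layer depends only on the size of the layer before it; consing
    [#|A|] makes [A] the layer before the first. *)
Lemma size_occs l A :
  size (occs l A) = \prod_(0 <= i < size l) 'C(nth 0 (#|A| :: l) i, nth 0 l i).
Proof.
elim: l A => [|a l IH] A; first by rewrite big_geq.
rewrite [LHS]size_allpairs_dep sumnE big_map big_enum /=.
rewrite big_nat_recl //= -cards_draws -sum1_card big_distrl /=.
apply: eq_bigr => B; rewrite inE => /andP[_ /eqP cB].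
by rewrite IH cB mul1n.
Qed.

(** * Sums and products over buckets in terms of the profile *)

Lemma bin_profile r i : #|[set b | r b == i.+1]| = profile r i - profile r i.+1.
Proof.
rewrite /profile -cardsDS; last by apply/subsetP=> b; rewrite !inE => /ltnW.
by apply: eq_card => b; rewrite !inE -leqNgt eqn_leq.
Qed.

Lemma profile_homo r i : profile r i.+1 <= profile r i.
Proof. by apply/subset_leq_card/subsetP => b; rewrite !inE => /ltnW. Qed.

Lemma profile_eq0 r i b : profile r i = 0 -> r b <= i.
Proof.
by move/eqP; rewrite cards_eq0 => /eqP/setP/(_ b); rewrite !inE ltnNge => /negbFE.
Qed.

(** Buckets are grouped by their load; [F 0 = 0] discards the empty ones. *)
Lemma sum_profile (F : nat -> nat) r k : (forall b, r b <= k) -> F 0 = 0 ->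
  \sum_b F (r b) = \sum_(0 <= i < k) (profile r i - profile r i.+1) * F i.+1.
Proof.
move=> r_le F0.
under eq_bigr => b _.
  have -> : F (r b) = \sum_(0 <= i < k) (r b == i.+1) * F i.+1.
    have := r_le b; case: (r b) => [_|m m_lt].
      by rewrite F0 big1.
    rewrite big_mkord (bigD1 (Ordinal m_lt)) //= eqxx mul1n big1 ?addn0 // => i.
    by rewrite -val_eqE /= eqSS eq_sym => /negPf->.
  over.
rewrite exchange_big; apply: eq_bigr => i _; rewrite -big_distrl /=.
rewrite -bin_profile -sum1_card [in RHS]big_mkcond; congr (_ * _).
by apply: eq_bigr => b _; rewrite inE; case: eqP.
Qed.

Lemma sum_profile_parts r k : (forall b, r b <= k) ->
  \sum_(0 <= i < k) profile r i = \sum_b r b.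
Proof.
move=> r_le; under eq_bigr do rewrite /profile -sum1_card big_mkcond.
rewrite exchange_big; apply: eq_bigr => b _.
under eq_bigr do rewrite inE.
rewrite -big_mkcond big_mkord (big_ord_narrow (r_le b)) /=.
by rewrite sum_nat_const card_ord muln1.
Qed.

(** Expand each factorial and swap the products: the factor [i.+1] occurs once for every bucket with
    more than [i] balls. *)
Lemma prod_fact_profile r k : (forall b, r b <= k) ->
  \prod_b (r b)`! = \prod_(0 <= i < k) i.+1 ^ profile r i.
Proof.
move=> r_le.
under [RHS]eq_bigr => i _.
  have -> : i.+1 ^ profile r i = \prod_b (if i < r b then i.+1 else 1).
    by rewrite -big_mkcond -prod_nat_const; apply: eq_bigl => b; rewrite inE.
  over.
rewrite [RHS]exchange_big; apply: eq_bigr => b _.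
rewrite -big_mkcond big_mkord (big_ord_narrow (r_le b)) /=.
by rewrite fact_prod big_add1 big_mkord.
Qed.

(** All size vectors with profile [l] have the same product of factorials, so each is realised by
    equally many arrangements. *)
Lemma card_occs q l : sumn l = q ->
  #|[set f : {ffun 'I_q -> T} | occ f \in occs l setT]|
    * \prod_(0 <= i < size l) i.+1 ^ nth 0 l i
  = q`! * \prod_(0 <= i < size l) 'C(nth 0 (#|T| :: l) i, nth 0 l i).
Proof.
move=> sum_l; rewrite -cardsT -size_occs mulnC.
transitivity (\sum_(r <- occs l setT) q`!); last first.
  by rewrite big_const_seq count_predT iter_addn_0.
have -> : #|[set f : {ffun 'I_q -> T} | occ f \in occs l setT]|
   = \sum_(r <- occs l setT) #|[set f : {ffun 'I_q -> T} | occ f == r]|.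
  under eq_bigr do rewrite -sum1_card big_mkcond.
  rewrite exchange_big /= -sum1_card big_mkcond /=; apply: eq_bigr => f _.
  rewrite inE; under eq_bigr do rewrite inE eq_sym.
  by rewrite -big_mkcond sum1_count count_uniq_mem ?occs_uniq //; case: (_ \in _).
rewrite big_distrr /= big_seq [RHS]big_seq; apply: eq_bigr => r /mem_occs[_ prof].
have r_le b : r b <= size l by apply: profile_eq0; rewrite prof nth_default.
rewrite mulnC -(@card_occ q r); last first.
  rewrite -(sum_profile_parts r_le) -sum_l sumnE [RHS](big_nth 0).
  by apply: eq_bigr => i _; apply: prof.
congr (_ * _); rewrite (prod_fact_profile r_le).
by apply: eq_bigr => i _; rewrite prof.
Qed.

(** * The partition attached to an arrangement *)

Definition conj_seq r : seq nat := mkseq (profile r) (\max_b r b).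

Lemma nth_conj_seq r : nth 0 (conj_seq r) =1 profile r.
Proof.
move=> i; case: (ltnP i (\max_b r b)) => [i_lt|i_ge]; first by rewrite nth_mkseq.
rewrite nth_default ?size_mkseq //; apply/esym/eq_card0 => b; rewrite inE.
by apply/negbTE; rewrite -leqNgt (leq_trans _ i_ge) // leq_bigmax.
Qed.

(** Cutting the profile at the maximal load keeps exactly its nonzero values, so all parts are
    positive. *)
Lemma conj_seqP q r : \sum_b r b = q -> is_intpart q (conj_seq r).
Proof.
move=> sum_r; apply/and3P; split.
- apply/(sortedP 0) => i _; rewrite !nth_conj_seq; exact: profile_homo.
- apply/(all_nthP 0) => i; rewrite size_mkseq nth_conj_seq lt0n => i_lt.
  apply: contraTN i_lt => /eqP prof0; rewrite -leqNgt.
  by apply/bigmax_leqP => b _; apply: profile_eq0.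
rewrite -sum_r sumnE big_map /index_iota -[X in iota _ X]subn0.
by apply/eqP/sum_profile_parts => b; apply: leq_bigmax.
Qed.

Definition occ_part q (f : {ffun 'I_q -> T}) : intpart q :=
  IntPart (conj_seqP (sum_occ f)).

Lemma occ_partE q (f : {ffun 'I_q -> T}) (l : intpart q) :
  (occ_part f == l) = (occ f \in occs l setT).
Proof.
apply/eqP/mem_occs => [<-|[_ prof]].
  by split=> [b|i]; rewrite ?inE //= nth_conj_seq.
apply: val_inj => /=.
(* Equality under [nth] ignores trailing zeros; positivity of the parts rules these out and forces
   equal lengths. *)
have size_le (l1 l2 : seq nat) : nth 0 l1 =1 nth 0 l2 -> all (leq 1) l1 ->
    size l1 <= size l2.
  move=> e /(all_nthP 0) pos; rewrite leqNgt; apply/negP => /pos.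
  by rewrite e nth_default.
have e : nth 0 (conj_seq (occ f)) =1 nth 0 l.
  by move=> i; rewrite nth_conj_seq prof.
have /and3P[_ pos1 _] := conj_seqP (sum_occ f).
have /and3P[_ pos2 _] := intpartP l.
apply: (@eq_from_nth _ 0) => [|i _]; last exact: e.
by apply/eqP; rewrite eqn_leq !size_le.
Qed.

End Occupancy.

(** * Collisions by partition, and the formula over the rationals *)

Lemma collisions_profile n q s (f : arrangement n q) (l : intpart q) :
  0 < s -> occ_part f == l ->
  collisions s f
  = \sum_(0 <= i < size l) (nth 0 l i - nth 0 l i.+1) * 'C(i.+1, s).
Proof.
move=> s_gt0; rewrite occ_partE => /mem_occs[_ prof].
transitivity (\sum_b 'C(occ f b, s)).
  by apply: eq_bigr => b _; rewrite ffunE.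
rewrite (@sum_profile _ (fun m => 'C(m, s)) _ (size l)); last by rewrite bin0n gtn_eqF.
  by apply: eq_bigr => i _; rewrite !prof.
by move=> b; apply: profile_eq0; rewrite prof nth_default.
Qed.

Lemma C_B_profile n q s : 0 < s ->
  C_B n q s = \sum_(l : intpart q)
    #|[set f : arrangement n q | occ_part f == l]|
    * \sum_(0 <= i < size l) (nth 0 l i - nth 0 l i.+1) * 'C(i.+1, s).
Proof.
move=> s_gt0; rewrite /C_B (partition_big (@occ_part _ q) xpredT) //=.
apply: eq_bigr => l _; rewrite -sum_nat_const.
by apply: eq_big => [f|f /(collisions_profile s_gt0)] //; rewrite inE.
Qed.

Local Open Scope ring_scope.

Theorem theorem6p4 (n q s : nat) (n_gt0 : (1 <= n)%N) (q_gt0 : (1 <= q)%N)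
    (s_gt1 : (2 <= s)%N) :
  (C_B n q s)%:R =
  \sum_(l : intpart q | (part l 1 <= n)%N && (s <= size l)%N)
     'C(n, part l 1)%:R
     * (\prod_(2 <= i < (size l).+1) 'C(part l i.-1, part l i)%:R)
     * ((part l (size l))%:R * 'C(size l, s)%:R
        + \sum_(s <= i < size l)
            ((part l i)%:R - (part l i.+1)%:R) * 'C(i, s)%:R)
     * (q`!%:R / \prod_(1 <= i < (size l).+1) i%:R ^+ part l i) :> rat.
Proof.
have s_gt0 := ltnW s_gt1.
rewrite C_B_profile // natr_sum [RHS]big_mkcond; apply: eq_bigr => l _.
have /and3P[srt _ /eqP sum_l] := intpartP l.
(* This makes truncated subtraction of consecutive parts agree with subtraction in [rat], also at
   the last part, where [nth] gives 0. *)
have l_noninc i : (nth 0 l i.+1 <= nth 0 l i)%N.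
  have [lt|ge] := ltnP i.+1 (size l); last by rewrite nth_default.
  exact: (sortedP 0%N srt).
have size_l : (0 < size l)%N.
  by case: (val l) sum_l q_gt0 => //= <-.
have card_l : (#|[set f : arrangement n q | occ_part f == l]|)%:R
  = 'C(n, part l 1)%:R
     * (\prod_(2 <= i < (size l).+1) 'C(part l i.-1, part l i)%:R)
     * (q`!%:R / \prod_(1 <= i < (size l).+1) i%:R ^+ part l i) :> rat.
  have den_neq0 : \prod_(1 <= i < (size l).+1) i%:R ^+ part l i != 0 :> rat.
    rewrite big_add1 prodf_seq_neq0; apply/allP => i _ /=.
    by rewrite expf_neq0 // pnatr_eq0.
  apply: (mulIf den_neq0); rewrite -!mulrA mulVf // mulr1.
  have := @card_occs 'I_n q l sum_l => /(congr1 (fun m => m%:R : rat)).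
  rewrite !natrM !natr_prod card_ord => eq_card.
  rewrite (_ : [set f | _] =
      [set f : {ffun 'I_q -> 'I_n} | occ f \in occs l setT]);
    last by apply/setP => f; rewrite !inE occ_partE.
  rewrite big_add1 /=; under eq_bigr do rewrite -natrX.
  rewrite [LHS]eq_card mulrA mulrC; congr (_ * _).
  (* The first binomial, with [n] on top, is split off; this uses that [l] is nonempty. *)
  rewrite big_ltn //= big_add1 big_add1 /= big_add1.
  by congr (_ * _).
rewrite natrM card_l.
(* Terms with index below [s] vanish. The range includes [size l], whose term becomes the separate
   last summand because the next part is 0. *)
have coll_l : (\sum_(0 <= i < size l)
      (nth 0%N l i - nth 0%N l i.+1) * 'C(i.+1, s))%:R
  = \sum_(s <= i < (size l).+1)
            ((part l i)%:R - (part l i.+1)%:R) * 'C(i, s)%:R :> rat.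
  rewrite natr_sum (big_nat_widenl s 1) // [RHS]big_mkcond big_add1 /=.
  apply: eq_bigr => i _; rewrite natrM natrB; last exact: l_noninc.
  by case: leqP => // lt; rewrite bin_small ?mulr0.
have part_last : part l (size l).+1 = 0%N by exact: nth_default.
rewrite coll_l; case: ifP => [/andP[_ s_le]|/negbT].
  rewrite [X in _ * X = _]big_nat_recr //= part_last subr0.
  by rewrite mulrAC [in LHS]addrC.
(* The excluded partitions contribute 0: if the first part exceeds [n], the first binomial vanishes;
   if there are fewer than [s] parts, the collision sum is empty. *)
rewrite negb_and -!ltnNge => /orP[lt|lt].
  by rewrite bin_small // !mul0r.
by rewrite [X in _ * X]big_geq // mulr0.
Qed.
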